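(* Let $(E(t))_{t\ge 0}$ be a well posed nonlinear semigroup on a normed vector space $(X,\|\cdot\|)$, and let $(C_{\Delta t})_{\Delta t\ge 0}$ be a numerical method associated with it which is convergent to it. Then the numerical method $(C_{\Delta t})$ is distantly stable.
   Context: Let $(X,\|\cdot\|)$ be a normed vector space. Nonlinear semigroup: a family of (not necessarily linear) mappings $E(t):X_t\to X$, $t\in[0,\infty)$, where the sets $X_t$ satisfy $X_{t+s}\subseteq X_t\subseteq X$ for all $t,s\in[0,\infty)$, $E(0)=\mathrm{id}_{X_0}$, and for all $t,s\in[0,\infty)$ one has $E(t)X_{t+s}\subseteq X_s$ and $E(t+s)u=E(s)E(t)u$ for every $u\in X_{t+s}$. Put $Z=\bigcup_{t\in[0,\infty)}\{t\}\times X_t\subseteq[0,\infty)\times X$. Well posed: the mapping $Z\ni(t,u)\mapsto E(t)u\in X$ is continuous. Numerical method associated with a well posed nonlinear semigroup: a continuous mapping $[0,\infty)\times X\ni(\Delta t,u)\mapsto C_{\Delta t}u\in X$ with $C_0=\mathrm{id}_X$. $C_{\Delta t}^n$ denotes the $n$-fold iterate of $C_{\Delta t}$. Regular subset: a subset $Z'\subseteq Z$ is regular if, writing $X'_t=\{u\in X_t : (t,u)\in Z'\}$ for $t\in[0,\infty)$, the following hold: $Z'$ is closed in $[0,\infty)\times X$; $E(t)X'_{t+s}\subseteq X'_s$ for all $t,s\in[0,\infty)$; $C_{\Delta t}X'_{t+\Delta t}\subseteq X'_t$ for all $t,\Delta t\in[0,\infty)$. Below, $X'_t$ always refers to the regular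 set $Z'$ under consideration. Convergent (to the semigroup): for every regular $Z'\subseteq Z$, $T\in(0,\infty)$, compact $K\subseteq X$ and $\epsilon>0$ there exists $\theta>0$ such that for all $t\in[0,T]$, $\Delta t>0$, $n\in\mathbb{N}$ and $u\in K\cap X'_t\cap X'_{n\Delta t}$: if $\Delta t\le\theta$ and $|t-n\Delta t|\le\theta$, then $\|E(t)u-C_{\Delta t}^n u\|\le\epsilon$. Distantly stable: for every regular $Z'\subseteq Z$, $T\in(0,\infty)$, compact $K\subseteq X$ and $\rho>0$ there exists $L''>0$ such that for all $\Delta t>0$, $n\in\mathbb{N}$ and $u,v\in K\cap X'_{n\Delta t}$: if $n\Delta t\le T$ and $\|v-u\|\ge\rho$, then $\|C_{\Delta t}^n v-C_{\Delta t}^n u\|\le L''\|v-u\|$. *)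

(* Defs.v *)
From HB Require Import structures.
From mathcomp Require Import all_boot all_order all_algebra.
From mathcomp Require Import all_classical all_reals all_analysis.
Set Implicit Arguments.
Unset Strict Implicit.
Unset Printing Implicit Defensive.
Import Order.TTheory GRing.Theory Num.Theory.
Import numFieldNormedType.Exports.
Local Open Scope classical_set_scope.
Local Open Scope ring_scope.

Section Semigroups.
Context {R : realType} {X : normedModType R}.
(* The partial maps E(t) : X_t -> X are encoded by their domains [D t] together
   with a total function [E t], whose values outside [D t] are irrelevant.
   Negative times are likewise irrelevant for [D], [E] and [C]. *)
Implicit Types (D : R -> set X) (E C : R -> X -> X) (Z : set (R * X)).

Definition time_space : set (R * X) := [set p | 0 <= p.1].

Record nonlinear_semigroup D E : Prop := {
  semigroup_dom : forall t s, 0 <= t -> 0 <= s -> D (t + s) `<=` D t;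
  semigroup_id : forall u, D 0 u -> E 0 u = u;
  semigroup_stable : forall t s, 0 <= t -> 0 <= s ->
    E t @` D (t + s) `<=` D s;
  semigroup_add : forall t s u, 0 <= t -> 0 <= s -> D (t + s) u ->
    E (t + s) u = E s (E t u)
}.

Definition graph_dom D : set (R * X) := [set p | 0 <= p.1 /\ D p.1 p.2].

Definition well_posed D E : Prop :=
  {within graph_dom D, continuous (fun p : R * X => E p.1 p.2)}.

Record numerical_method C : Prop := {
  method_continuous :
    {within time_space, continuous (fun p : R * X => C p.1 p.2)};
  method_id : forall u, C 0 u = u
}.

Definition slice D Z (t : R) : set X := [set u | D t u /\ Z (t, u)].

(* [closed (Z : set (subspace time_space))] is relative closedness of [Z] in
   [0, oo) x X. *)
Record regular_subset D E C Z : Prop := {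
  regular_sub : Z `<=` graph_dom D;
  regular_closed : closed (Z : set (subspace time_space));
  regular_semigroup : forall t s, 0 <= t -> 0 <= s ->
    E t @` slice D Z (t + s) `<=` slice D Z s;
  regular_method : forall t dt, 0 <= t -> 0 <= dt ->
    C dt @` slice D Z (t + dt) `<=` slice D Z t
}.

Definition convergent_method D E C : Prop :=
  forall Z, regular_subset D E C Z ->
  forall T : R, 0 < T ->
  forall K : set X, compact K ->
  forall e : R, 0 < e ->
  exists2 theta : R, 0 < theta &
    forall (t dt : R) (n : nat) (u : X),
      0 <= t -> t <= T -> 0 < dt ->
      K u -> slice D Z t u -> slice D Z (n%:R * dt) u ->
      dt <= theta -> `|t - n%:R * dt| <= theta ->
      `|E t u - iter n (C dt) u| <= e.

Definition distantly_stable D E C : Prop :=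
  forall Z, regular_subset D E C Z ->
  forall T : R, 0 < T ->
  forall K : set X, compact K ->
  forall rho : R, 0 < rho ->
  exists2 L : R, 0 < L &
    forall (dt : R) (n : nat) (u v : X),
      0 < dt ->
      K u -> slice D Z (n%:R * dt) u ->
      K v -> slice D Z (n%:R * dt) v ->
      n%:R * dt <= T -> rho <= `|v - u| ->
      `|iter n (C dt) v - iter n (C dt) u| <= L * `|v - u|.

End Semigroups.

(* Main.v *)
Require Import Defs.
From mathcomp Require Import all_boot all_order all_algebra.
From mathcomp Require Import all_classical all_reals all_analysis.
Import numFieldNormedType.Exports.
Import Order.TTheory GRing.Theory Num.Theory.
Local Open Scope classical_set_scope.
Local Open Scope ring_scope.

(** Distant stability only compares points at distance at least [rho], so it
    is a boundedness statement in disguise: if all iterates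
    [iter n (C dt) u] that occur have norm at most [M], then
    [2 M <= (2 M / rho) * `|v - u|] and [2 M / rho] is a stability constant.

    The uniform bound ([convergent_iterates_bounded]) comes from splitting the
    time steps at the threshold [theta] that convergence provides for the
    error [1].  For [dt <= theta], the iterate is within [1] of the exact
    solution [E (n%:R * dt) u], and [E] is bounded on the compact part of the
    regular set lying over [[0, T]] and [K].  For [dt > theta], at most
    [T / theta] iterations fit into [[0, T]], and each of these finitely
    many iterates is jointly continuous in the time step and the point
    ([continuous_iter_method]), hence bounded on the compact set
    [[0, T] * K]. *)

Lemma compact_image_norm_bound (R : realType) (T : topologicalType)
    (X : normedModType R) (A : set T) (f : T -> X) :
  compact A -> {within A, continuous f} ->
  exists2 M : R, 0 < M & forall x, A x -> `|f x| <= M.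
Proof.
move=> cA cf.
have /compact_bounded/pinfty_ex_gt0[M M0 fM] := continuous_compact cf cA.
by exists M => // x Ax; apply: fM; exists x.
Qed.

(** The step from [n] to [n.+1] composes [C] with the map
    [(dt, u) |-> (dt, iter n (C dt) u)]; continuity on the half-space of
    nonnegative times survives because this map leaves the time unchanged. *)
Lemma continuous_iter_method (R : realType) (X : normedModType R)
    (C : R -> X -> X) (n : nat) :
  {within time_space, continuous (fun p : R * X => C p.1 p.2)} ->
  {within time_space, continuous (fun p : R * X => iter n (C p.1) p.2)}.
Proof.
move=> cC; elim: n => [|n IHn]; apply/subspace_continuousP => p p0 /=.
  by apply: cvg_within_filter; exact: cvg_snd.
have step : (q.1, iter n (C q.1) q.2) @[q --> within time_space (nbhs p)] -->
    (p.1, iter n (C p.1) p.2).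
  apply: (@cvg_pair _ _ _ _ (nbhs p.1) (nbhs (iter n (C p.1) p.2))).
    by apply: cvg_within_filter; exact: cvg_fst.
  by have /subspace_continuousP/(_ p p0) := IHn.
have step0 : (q.1, iter n (C q.1) q.2) @[q --> within time_space (nbhs p)]
    `=>` within time_space (nbhs (p.1, iter n (C p.1) p.2)).
  move=> U qU; have := step _ qU; rewrite /within /= /nbhs /=.
  by apply: filterS => q qU' q0; exact: qU'.
have /subspace_continuousP/(_ (p.1, iter n (C p.1) p.2) p0) := cC.
exact: cvg_comp step0.
Qed.

Lemma compact_bounded_time (R : realType) (X : normedModType R) (T : R)
    (K : set X) :
  compact K -> compact (`[0, T]%classic `*` K).
Proof. by move=> cK; apply: compact_setX => //; exact: segment_compact. Qed.

(** Relative closedness in the half-space of nonnegative times suffices,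
    since [`[0, T] `*` K] lies inside that half-space. *)
Lemma compact_regular_subset (R : realType) (X : normedModType R)
    (D : R -> set X) (E C : R -> X -> X) (Z : set (R * X)) (T : R)
    (K : set X) :
  regular_subset D E C Z -> compact K ->
  compact ((`[0, T]%classic `*` K) `&` Z).
Proof.
move=> rZ cK; have /closed_subspaceP[V cV VZ] := regular_closed rZ.
suff -> : (`[0, T]%classic `*` K) `&` Z = (`[0, T]%classic `*` K) `&` V.
  by apply: compact_closedI => //; exact: compact_bounded_time.
apply/seteqP; split=> p [[tT Kp] Zp]; split => //.
  have [//] : (V `&` time_space) p.
  by rewrite VZ; split => //; move: tT; rewrite /= in_itv /= => /andP[].
have [//] : (Z `&` time_space) p.
by rewrite -VZ; split => //; move: tT; rewrite /= in_itv /= => /andP[].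
Qed.

Lemma common_bound (R : realType) (T : Type) (A : set T) (f : nat -> T -> R)
    (N : nat) :
  (forall n, exists2 M : R, 0 < M & forall x, A x -> f n x <= M) ->
  exists2 M : R, 0 < M & forall n x, (n <= N)%N -> A x -> f n x <= M.
Proof.
move=> fM; elim: N => [|N [M M0 IHM]].
  have [M M0 f0M] := fM 0%N.
  by exists M => // n x; rewrite leqn0 => /eqP ->; exact: f0M.
have [M' M'0 fM'] := fM N.+1.
exists (M + M'); first exact: addr_gt0.
move=> n x; rewrite leq_eqVlt => /predU1P[->|nN] Ax.
  by apply: le_trans (fM' x Ax) _; rewrite lerDr ltW.
by apply: le_trans (IHM n x nN Ax) _; rewrite lerDl ltW.
Qed.

(** A single bound for all step sizes: convergence controls the small steps
    through the semigroup, continuity of finitely many iterates controls the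
    large ones. *)
Lemma convergent_iterates_bounded (R : realType) (X : normedModType R)
    (D : R -> set X) (E C : R -> X -> X) (Z : set (R * X)) (T : R)
    (K : set X) :
  well_posed D E -> numerical_method C -> convergent_method D E C ->
  regular_subset D E C Z -> 0 < T -> compact K ->
  exists2 M : R, 0 < M &
    forall (dt : R) (n : nat) (u : X),
      0 < dt -> K u -> slice D Z (n%:R * dt) u -> n%:R * dt <= T ->
      `|iter n (C dt) u| <= M.
Proof.
move=> wpE nmC cvC rZ T0 cK.
have [theta theta0 errC] := cvC Z rZ T T0 K cK 1 ltr01.
have [ME ME0 EM] : exists2 M : R, 0 < M &
    forall p : R * X, ((`[0, T]%classic `*` K) `&` Z) p -> `|E p.1 p.2| <= M.
  apply: compact_image_norm_bound; first exact: compact_regular_subset rZ cK.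
  apply: continuous_subspaceW wpE => p [_]; exact: (regular_sub rZ).
pose N := Num.truncn (T / theta).
have [MC MC0 CM] : exists2 M : R, 0 < M &
    forall n (p : R * X), (n <= N)%N -> (`[0, T]%classic `*` K) p ->
      `|iter n (C p.1) p.2| <= M.
  apply: (@common_bound _ _ _ (fun n p => `|iter n (C p.1) p.2|)) => n.
  apply: compact_image_norm_bound; first exact: compact_bounded_time.
  apply: continuous_subspaceW (continuous_iter_method _ _ C n _).
    by move=> p [/=]; rewrite in_itv /= => /andP[].
  exact: method_continuous nmC.
exists (ME + 1 + MC); first by rewrite !addr_gt0.
move=> dt n u dt0 Ku Zu ndtT.
have ndt0 : 0 <= n%:R * dt by rewrite mulr_ge0 // ltW.
have [dt_small|dt_large] := leP dt theta.
  have err : `|E (n%:R * dt) u - iter n (C dt) u| <= 1.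
    by apply: errC => //; rewrite subrr normr0 ltW.
  have EuM : `|E (n%:R * dt) u| <= ME.
    apply: (EM (n%:R * dt, u)); split; last by case: Zu.
    by split => //=; rewrite in_itv /= ndt0.
  apply: (@le_trans _ _ (ME + 1)); last by rewrite lerDl ltW.
  rewrite -[iter _ _ _](subKr (E (n%:R * dt) u)).
  by apply: le_trans (ler_normB _ _) (lerD _ _).
apply: (@le_trans _ _ MC); last by rewrite lerDr addr_ge0 // ltW.
case: n Zu ndtT ndt0 => [|n] Zu ndtT ndt0.
  (* With no iteration the step size is unconstrained and may exceed [T];
     the value does not depend on it, so the step [0] can be used instead. *)
  by apply: (CM 0%N (0, u)) => //; split => //=; rewrite in_itv /= lexx ltW.
apply: (CM n.+1 (dt, u)).
  rewrite truncn_ge_nat ?divr_ge0 ?(ltW T0) ?(ltW theta0) // ler_pdivlMr //.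
  by apply: le_trans ndtT; rewrite ler_wpM2l // ltW.
split => //=; rewrite in_itv /= (ltW dt0) /=.
by apply: le_trans ndtT; rewrite ler_peMl ?(ltW dt0) // ler1n.
Qed.

Theorem theorem3p1 (R : realType) (X : normedModType R)
  (D : R -> set X) (E : R -> X -> X) (C : R -> X -> X) :
  nonlinear_semigroup D E ->
  well_posed D E ->
  numerical_method C ->
  convergent_method D E C ->
  distantly_stable D E C.
Proof.
move=> _ wpE nmC cvC Z rZ T T0 K cK rho rho0.
have [M M0 CM] :=
  @convergent_iterates_bounded R X D E C Z T K wpE nmC cvC rZ T0 cK.
exists ((M + M) / rho); first by rewrite divr_gt0 // addr_gt0.
move=> dt n u v dt0 Ku Zu Kv Zv ndtT uv.
apply: (@le_trans _ _ (M + M)).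
  by apply: le_trans (ler_normB _ _) (lerD _ _); apply: CM.
by rewrite -mulrA ler_peMr ?addr_ge0 ?(ltW M0) // mulrC ler_pdivlMr ?mul1r.
Qed.
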